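(* Let $M$ be a complex manifold and $F$ a complex Finsler metric on $M$. (i) $F$ is of complex Randers type, i.e. of the form $F(z,\eta)=\alpha+|\beta|$, if and only if it solves the generalized Zermelo navigation problem on some Hermitian manifold $(M,h)$, with space-dependent ship's speed $\|u\|_h$, under the influence of a wind $W$ satisfying $0<\|W\|_h<\|u\|_h\le 1$ and $\cos\varphi=-1$. (ii) $F$ is a Hermitian metric conformal to $h$ if and only if it solves the generalized Zermelo navigation problem on some Hermitian manifold $(M,h)$, with space-dependent ship's speed $\|u\|_h$, under the influence of a wind $W$ satisfying either $0<\|W\|_h<\|u\|_h\le 1$ and $\cos\varphi=0$, or $W=0$. Also, $F$ is Hermitian and homothetic to $h$ if and only if either $\cos\varphi=0$ and $\tilde\varepsilon=\|u\|_h^2-\|W\|_h^2$ is constant, or $W=0$ and $\|u\|_h$ is constant.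
   Context: Complex Finsler metric: a continuous function $F:T'M\to\mathbb{R}_{\ge0}$ on the holomorphic tangent bundle, smooth away from the zero section, vanishing only there, with $F(z,\lambda\eta)=|\lambda|F(z,\eta)$ for $\lambda\in\mathbb{C}$, and with $g_{i\bar j}=\frac{\partial^2F^2}{\partial\eta^i\partial\bar\eta^j}$ positive definite. For $F=\alpha+|\beta|$ the smoothness and positivity conditions are understood at points with $\beta\ne0$. Complex Randers metric: $F=\alpha+|\beta|$ with $\alpha(z,\eta)=\sqrt{a_{i\bar j}(z)\eta^i\bar\eta^j}$ for a Hermitian metric $a$ on $M$, $\beta(z,\eta)=b_i(z)\eta^i$ for a differential $(1,0)$-form $b$, and $0<\|b\|^2<1$, where $\|b\|^2=a^{\bar ji}b_ib_{\bar j}$. Generalized Zermelo navigation problem (ZNP): the data are a Hermitian metric $h=h_{i\bar j}(z)\,dz^i\otimes d\bar z^j$ on $M$, a smooth section $W=W^i\frac{\partial}{\partial z^i}$ of $T'M$ (the wind), and a smooth function $f=\|u\|_h$ on $M$ (the ship's speed relative to the wind) with $\|W\|_h<f\le1$; here $\|\eta\|_h=\sqrt{h_{i\bar j}\eta^i\bar\eta^j}$ and $h(\eta,\bar W)=h_{i\bar j}\eta^i\bar W^j$. Put $\tilde\varepsilon=\|u\|_h^2-\|W\|_h^2>0$. The resultant velocity is $v=u+W$, so $\|v-W\|_h=f$, and the solution $F$ is normalized by $F(z,v)=1$. When $W$ is nowhere zero, $\varphi=\arg h(v,\bar W)$ is assumed to be a constant angle, so that $\mathrm{Re}\,h(v,\bar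 W)=|h(v,\bar W)|\cos\varphi$; extending by $|\lambda|$-homogeneity, the solution of the generalized ZNP with data $(h,\|u\|_h,W)$ and angle $\varphi$ is, by definition, $$F(z,\eta)=\frac{\sqrt{|h(\eta,\bar W)|^2\cos^2\varphi+\|\eta\|_h^2\,\tilde\varepsilon}-|h(\eta,\bar W)|\cos\varphi}{\tilde\varepsilon}.$$ When $W=0$ the solution is $F(z,\eta)=\frac{1}{\|u\|_h}\|\eta\|_h$. A Hermitian metric $F$ is conformal to $h$ if $F(z,\eta)=\rho(z)\|\eta\|_h$ for a smooth positive function $\rho$ on $M$, and homothetic to $h$ if $\rho$ is constant. *)

(* Defs.v *)
From HB Require Import structures.
From mathcomp Require Import all_boot all_order all_algebra.
From mathcomp Require Import all_classical all_reals all_analysis.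
From mathcomp Require Import complex.

Set Implicit Arguments.
Unset Strict Implicit.
Unset Printing Implicit Defensive.

Import Order.TTheory GRing.Theory Num.Theory.
Import numFieldNormedType.Exports.

Local Open Scope classical_set_scope.
Local Open Scope ring_scope.

(* R[i] bundled as a numClosedFieldType: this is what makes 'rV[Cx R]_n a
   normed module over the complex numbers, so that [differentiable] below
   means complex differentiable. *)
Definition Cx (R : realType) : numClosedFieldType := R[i].

Definition cmod (R : realType) (z : Cx R) : R := complex.Re `|z|.

Section RealSmoothness.
Context {R : realType} {X : normedModType (Cx R)}.
Implicit Types (f : X -> R) (g : X -> Cx R) (x v : X) (A : set X).

(* X is only a complex normed module, so directional derivatives in the real
   sense are taken along the real lines t |-> x + t v. *)
Definition real_line f x v : R -> R := fun t => f (x + (t%:C)%C *: v).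

Definition rderivable f x v : Prop := derivable (real_line f x v) 0 1.

Definition rderive v f : X -> R := fun x => 'D_1 (real_line f x v) 0.

(* All iterated real directional derivatives of order at most k exist and are
   continuous on A; intended for A open and X of finite dimension. *)
Fixpoint Ck (k : nat) A f : Prop :=
  (forall x, A x -> {for x, continuous f}) /\
  (if k is k'.+1 then
     forall v, (forall x, A x -> rderivable f x v) /\ Ck k' A (rderive v f)
   else True).

Definition smooth_on A f : Prop := forall k, Ck k A f.

Definition csmooth_on A g : Prop :=
  smooth_on A (fun x => complex.Re (g x)) /\
  smooth_on A (fun x => complex.Im (g x)).

Definition cderive v g : X -> Cx R := fun x =>
  (rderive v (fun y => complex.Re (g y)) x +i*
   rderive v (fun y => complex.Im (g y)) x)%C.

(* Wirtinger operators: for v the k-th vector of the canonical basis of C^n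
   these are d/d eta^k and d/d (conj eta^k). *)
Definition wirtinger v g : X -> Cx R := fun x =>
  (cderive v g x - 'i * cderive ('i *: v) g x) / 2.

Definition wirtinger_bar v g : X -> Cx R := fun x =>
  (cderive v g x + 'i * cderive ('i *: v) g x) / 2.

End RealSmoothness.

Section HermitianAlgebra.
Context {R : realType} {n : nat}.
Implicit Types (G : 'M[Cx R]_n) (v w b : 'rV[Cx R]_n).

Definition hform G v w : Cx R :=
  \sum_(i < n) \sum_(j < n) G i j * v 0 i * (w 0 j)^*.

(* 0 < z in Cx R means that z is real and positive. *)
Definition posdef G : Prop := forall v, v != 0 -> 0 < hform G v v.

Definition hnorm G v : R := Num.sqrt (complex.Re (hform G v v)).

Definition pairing b v : Cx R := \sum_(i < n) b 0 i * v 0 i.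

(* a^{bar j i} b_i conj(b_j), where a^{bar j i} is the (j, i) entry of the
   inverse of the matrix (a_{i bar j}). *)
Definition conorm2 G b : R :=
  complex.Re (\sum_(i < n) \sum_(j < n) (invmx G) j i * b 0 i * (b 0 j)^*).

(* The matrix g_{i bar j} = d^2 (f^2) / d eta^i d (conj eta^j) at v. *)
Definition levi (f : 'rV[Cx R]_n -> R) v : 'M[Cx R]_n :=
  \matrix_(i < n, j < n)
    wirtinger (delta_mx 0 i)
      (wirtinger_bar (delta_mx 0 j) (fun w => ((f w ^+ 2)%:C)%C : Cx R)) v.

End HermitianAlgebra.

Record complex_manifold (R : realType) (n : nat) := ComplexManifold {
  points :> topologicalType;
  chart : Type;
  dom : chart -> set points;
  coord : chart -> points -> 'rV[Cx R]_n;
  param : chart -> 'rV[Cx R]_n -> points;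
  chart_at : points -> chart;
  points_hausdorff : hausdorff_space points;
  points_second_countable : @second_countable points;
  dom_open : forall c, open (dom c);
  image_open : forall c, open (coord c @` dom c);
  coordK : forall c p, dom c p -> param c (coord c p) = p;
  coord_cts : forall c p, dom c p -> {for p, continuous (coord c)};
  param_cts : forall c x, (coord c @` dom c) x -> {for x, continuous (param c)};
  mem_chart_at : forall p, dom (chart_at p) p;
  transition_holomorphic : forall c d x, (coord c @` (dom c `&` dom d)) x ->
    differentiable (coord d \o param c) x
}.

(* The holomorphic tangent space T'_pM is identified with C^n by taking
   components with respect to the chart [chart_at p].  Hence a function on T'M
   is a map M -> C^n -> R, and vector fields, (1,0)-forms and Hermitian metrics
   are given by their components at p in [chart_at p].  Since [chart_at] may
   jump, continuity and smoothness are always expressed through components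
   with respect to a fixed chart c, obtained with [from_chart] / [to_chart]. *)
Section Tensors.
Context {R : realType} {n : nat} {M : complex_manifold R n}.
Local Notation C := (Cx R).
Implicit Types (c : chart M) (p : M).

Definition chart_image c : set 'rV[C]_n := coord c @` dom c.

(* The element of T'_pM whose components in the chart c are v. *)
Definition from_chart c p (v : 'rV[C]_n) : 'rV[C]_n :=
  'd (coord (chart_at p) \o param c) (coord c p) v.

(* The components in the chart c of the element v of T'_pM. *)
Definition to_chart c p (v : 'rV[C]_n) : 'rV[C]_n :=
  'd (coord c \o param (chart_at p)) (coord (chart_at p) p) v.

Definition coord_vector c p (k : 'I_n) : 'rV[C]_n :=
  from_chart c p (delta_mx 0 k).

Definition smooth_function (f : M -> R) : Prop :=
  forall c, smooth_on (chart_image c) (f \o param c).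

Definition smooth_vector_field (W : M -> 'rV[C]_n) : Prop :=
  forall c k, csmooth_on (chart_image c)
    (fun x => to_chart c (param c x) (W (param c x)) 0 k).

Definition smooth_form (b : M -> 'rV[C]_n) : Prop :=
  forall c k, csmooth_on (chart_image c)
    (fun x => pairing (b (param c x)) (coord_vector c (param c x) k)).

Definition hermitian_metric (h : M -> 'M[C]_n) : Prop :=
  [/\ forall p i j, h p j i = (h p i j)^*,
      forall p, posdef (h p) &
      forall c k l, csmooth_on (chart_image c)
        (fun x => hform (h (param c x)) (coord_vector c (param c x) k)
                                        (coord_vector c (param c x) l))].

Definition local_rep (F : M -> 'rV[C]_n -> R) c (x : 'rV[C]_n * 'rV[C]_n) : R :=
  F (param c x.1) (from_chart c (param c x.1) x.2).

Definition finsler_regular_on (S : M -> set 'rV[C]_n) (F : M -> 'rV[C]_n -> R) :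
    Prop :=
  (forall c, smooth_on
     [set x : 'rV[C]_n * 'rV[C]_n | chart_image c x.1 /\
        S (param c x.1) (from_chart c (param c x.1) x.2)] (local_rep F c)) /\
  (forall p v, S p v -> posdef (levi (F p) v)).

(* Functions alpha + |beta| are not smooth where beta = 0, and for them
   smoothness and positivity are only required at points with beta <> 0.  This
   is accounted for by the second alternative of the last clause, in which
   regularity may fail along the kernel of some nowhere zero (1,0)-form; it does
   not presuppose that F is of the form alpha + |beta|. *)
Definition complex_finsler (F : M -> 'rV[C]_n -> R) : Prop :=
  [/\ forall p v, 0 <= F p v,
      forall p v, F p v = 0 <-> v = 0,
      forall c x, chart_image c x.1 -> {for x, continuous (local_rep F c)},
      forall p (l : C) v, F p (l *: v) = cmod l * F p v &
      finsler_regular_on (fun _ => [set v | v != 0]) F \/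
      exists b : M -> 'rV[C]_n,
        [/\ smooth_form b, forall p, b p != 0 &
            finsler_regular_on (fun p => [set v | pairing (b p) v != 0]) F]].

Definition complex_randers (F : M -> 'rV[C]_n -> R) : Prop :=
  exists (a : M -> 'M[C]_n) (b : M -> 'rV[C]_n),
    [/\ hermitian_metric a, smooth_form b,
        forall p, 0 < conorm2 (a p) (b p) < 1 &
        forall p v, F p v = hnorm (a p) v + cmod (pairing (b p) v)].

(* In what follows h is the background metric, f = ||u||_h the ship's speed
   relative to the wind, W the wind and phi the angle. *)
Definition navigation_data
    (h : M -> 'M[C]_n) (f : M -> R) (W : M -> 'rV[C]_n) : Prop :=
  [/\ hermitian_metric h, smooth_function f, smooth_vector_field W &
      forall p, hnorm (h p) (W p) < f p <= 1].

Definition nav_eps (h : M -> 'M[C]_n) (f : M -> R) (W : M -> 'rV[C]_n) : M -> R :=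
  fun p => f p ^+ 2 - hnorm (h p) (W p) ^+ 2.

Definition nav_formula (h : M -> 'M[C]_n) (f : M -> R) (W : M -> 'rV[C]_n)
    (phi : R) : M -> 'rV[C]_n -> R :=
  fun p v =>
    (Num.sqrt (cmod (hform (h p) v (W p)) ^+ 2 * cos phi ^+ 2
               + hnorm (h p) v ^+ 2 * nav_eps h f W p)
     - cmod (hform (h p) v (W p)) * cos phi) / nav_eps h f W p.

Definition nowhere_zero (W : M -> 'rV[C]_n) : Prop := forall p, W p != 0.

Definition zero_wind (W : M -> 'rV[C]_n) : Prop := forall p, W p = 0.

(* For the zero wind the angle phi plays no role. *)
Definition solves_navigation (F : M -> 'rV[C]_n -> R)
    (h : M -> 'M[C]_n) (f : M -> R) (W : M -> 'rV[C]_n) (phi : R) : Prop :=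
  navigation_data h f W /\
  ((nowhere_zero W /\ forall p v, F p v = nav_formula h f W phi p v) \/
   (zero_wind W /\ forall p v, F p v = (f p)^-1 * hnorm (h p) v)).

Definition conformal (F : M -> 'rV[C]_n -> R) (h : M -> 'M[C]_n) : Prop :=
  hermitian_metric h /\
  exists rho : M -> R,
    [/\ smooth_function rho, forall p, 0 < rho p &
        forall p v, F p v = rho p * hnorm (h p) v].

Definition homothetic (F : M -> 'rV[C]_n -> R) (h : M -> 'M[C]_n) : Prop :=
  hermitian_metric h /\
  exists2 rho : R, 0 < rho & forall p v, F p v = rho * hnorm (h p) v.

Definition constant_function (f : M -> R) : Prop := exists k, forall p, f p = k.

End Tensors.

(* Main.v *)
Require Import Defs.
From mathcomp Require Import all_boot all_order all_algebra.
From mathcomp Require Import all_classical all_reals all_analysis.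
From mathcomp Require Import complex ring lra.

(* Write X for the vector dual to b, i.e. a(v, conj X) = b(v), and
   B = ||b||^2 = a(X, conj X).  A Randers metric alpha + |beta| with data (a, b)
   solves the navigation problem with unit ship's speed for
     h = (1 - B) (a - b (x) conj b),   W = X / (1 - B),
   for which ||W||_h^2 = B, eps = 1 - B and h(v, conj W) = (1 - B) b(v); h is
   positive definite by the Cauchy-Schwarz inequality |b(v)|^2 <= B a(v, conj v).
   Conversely the solution with cos phi = -1 is alpha + |beta| for
     b = h(., conj W) / eps,   a = h / eps + b (x) conj b,
   and ||b||^2 = ||W||_h^2 / f^2.  For cos phi = 0 the solution is
   ||.||_h / sqrt eps, and for W = 0 it is ||.||_h / f; conversely rho ||.||_h
   solves the problem without wind at unit speed for the metric rho^2 h.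
   Smoothness of W follows from Cramer's rule for the matrix of a in a chart. *)

Set Implicit Arguments.
Unset Strict Implicit.
Unset Printing Implicit Defensive.

Import Order.TTheory GRing.Theory Num.Theory.
Import numFieldNormedType.Exports.

Local Open Scope classical_set_scope.
Local Open Scope ring_scope.

(** * Real smoothness *)

Section Smoothness.
Context {R : realType} {X : normedModType (Cx R)}.
Implicit Types (f g : X -> R) (x v : X) (A : set X).

Lemma real_line_cvg x v : x + (t%:C)%C *: v @[t --> (0 : R)] --> x.
Proof.
rewrite -[X in _ --> X]addr0 -(scale0r v).
apply: cvgD; first exact: cvg_cst.
apply: cvgZr_tmp.
apply/cvgrPdist_lt => e e0.
(* A positive element of [Cx R] is real, so the radius [e] may be replaced by its real part and the
   estimate carried out in [R]. *)
have er : (complex.Re e)%:C%C = e by apply: RRe_real; apply: gtr0_real.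
have e0' : 0 < complex.Re e by rewrite -ltcR er.
near=> t.
rewrite sub0r normrN -er normc_def /= expr0n addr0 sqrtr_sqr ltcR -[t]subr0 -normrN opprB.
by near: t; apply: (@cvgr_dist_lt _ _ _ _ _ id 0) => //; exact: cvg_id.
Unshelve. all: by end_near. Qed.

(** Derivatives only see the real line through [x]; this transfers a property of the open set [A] to
    small parameters on that line. *)
Lemma near_real_line A x v (P : X -> Prop) : open A -> A x ->
  (forall y, A y -> P y) -> \forall t \near (0 : R), P (x + (t%:C)%C *: v).
Proof.
move=> oA Ax AP.
have nA : nbhs x A by exact: open_nbhs_nbhs.
have : \forall t \near (0 : R), A (x + (t%:C)%C *: v) := real_line_cvg v nA.
move=> H; near=> t; apply: AP; near: t; exact: H.
Unshelve. all: by end_near.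
Qed.

Lemma real_line0 f x v : real_line f x v 0 = f x.
Proof. by rewrite /real_line scale0r addr0. Qed.

Lemma rderivable_ext A f g v x : open A -> (forall y, A y -> f y = g y) ->
  A x -> rderivable f x v -> rderivable g x v.
Proof.
move=> oA fg Ax; apply: near_eq_derivable.
exact: (@near_real_line A x v (fun y => f y = g y)).
Qed.

Lemma rderive_ext A f g v x : open A -> (forall y, A y -> f y = g y) ->
  A x -> rderive v f x = rderive v g x.
Proof.
move=> oA fg Ax; apply: near_eq_derive.
exact: (@near_real_line A x v (fun y => f y = g y)).
Qed.

(** Openness of [A] matters: continuity and derivatives at a point of [A] involve values at all
    nearby points of [X]. *)
Lemma Ck_ext k A f g : open A -> (forall y, A y -> f y = g y) ->
  Ck k A f -> Ck k A g.
Proof.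
move=> oA; elim: k f g => [|k IH] f g fg [cf df]; split=> //.
1, 2: move=> x Ax; rewrite /prop_for /continuous_at -(fg x Ax).
1, 2: apply: cvg_trans (cf x Ax); apply: near_eq_cvg.
1, 2: by near=> y; apply: fg; near: y; exact: open_nbhs_nbhs.
move=> v; have [dfv Cdf] := df v; split.
  by move=> x Ax; apply: (rderivable_ext oA fg) (dfv x Ax).
by apply: IH Cdf => y Ay; exact: rderive_ext Ay.
Unshelve. all: by end_near. Qed.

Lemma CkS k A f : Ck k.+1 A f -> Ck k A f.
Proof.
elim: k f => [|k IH] f [cf df]; split=> // v.
by have [dfv Cdf] := df v; split=> //; exact: IH.
Qed.

Lemma Ck_cst k A (c : R) : Ck k A (fun=> c).
Proof.
elim: k c => [|k IH] c; split=> //.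
1, 2: by move=> x _; exact: cst_continuous.
move=> v; split=> [x _|]; first exact: derivable_cst.
have -> : rderive v (fun=> c) = (fun=> 0); last exact: IH.
by apply/funext => x; exact: derive_cst.
Qed.

Lemma CkD k A f g : open A -> Ck k A f -> Ck k A g ->
  Ck k A (fun x => f x + g x).
Proof.
move=> oA; elim: k f g => [|k IH] f g [cf df] [cg dg]; split=> //.
1, 2: by move=> x Ax; exact: cvgD (cf x Ax) (cg x Ax).
move=> v; have [dfv Cdf] := df v; have [dgv Cdg] := dg v; split.
  by move=> x Ax; exact: derivableD (dfv x Ax) (dgv x Ax).
apply: Ck_ext (IH _ _ Cdf Cdg) => // x Ax.
by rewrite -(deriveD (dfv x Ax) (dgv x Ax)).
Qed.

(** By the Leibniz rule the derivative is f g' + g f'; [CkS] lowers the order of the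
    undifferentiated factors so that the induction hypothesis applies. *)
Lemma CkM k A f g : open A -> Ck k A f -> Ck k A g ->
  Ck k A (fun x => f x * g x).
Proof.
move=> oA; elim: k f g => [|k IH] f g Cf Cg; split=> //.
1, 2: by move=> x Ax; have [cf _] := Cf; have [cg _] := Cg;
  exact: cvgM (cf x Ax) (cg x Ax).
move=> v; have [_ /(_ v)[dfv Cdf]] := Cf; have [_ /(_ v)[dgv Cdg]] := Cg.
split; first by move=> x Ax; exact: derivableM (dfv x Ax) (dgv x Ax).
apply: Ck_ext (CkD oA (IH _ _ (CkS Cf) Cdg) (IH _ _ (CkS Cg) Cdf)) => // x Ax.
rewrite -{1}(real_line0 f x v) -{1}(real_line0 g x v).
exact: esym (deriveM (dfv x Ax) (dgv x Ax)).
Qed.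

(** The derivative -(1/f)^2 f' contains only 1/f and f', so the induction on [k] closes. *)
Lemma CkV k A f : open A -> (forall x, A x -> f x != 0) -> Ck k A f ->
  Ck k A (fun x => (f x)^-1).
Proof.
move=> oA f0; elim: k => [|k IH] Cf; split=> //.
1, 2: by move=> x Ax; have [cf _] := Cf; exact: cvgV (f0 x Ax) (cf x Ax).
move=> v; have [_ /(_ v)[dfv Cdf]] := Cf.
have f0' x : A x -> real_line f x v 0 != 0 by rewrite real_line0; exact: f0.
split; first by move=> x Ax; exact: derivableV (f0' x Ax) (dfv x Ax).
have CV := IH (CkS Cf).
apply: Ck_ext (CkM oA (CkM oA (Ck_cst k A (-1)) (CkM oA CV CV)) Cdf) => // x Ax.
rewrite [RHS](deriveV (f0' x Ax) (dfv x Ax)) real_line0.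
by rewrite mulN1r -invfM -expr2.
Qed.

(** The derivative is f' / (2 sqrt f): the induction hypothesis covers sqrt f, and [CkV] its
    inverse. *)
Lemma Ck_sqrt k A f : open A -> (forall x, A x -> 0 < f x) -> Ck k A f ->
  Ck k A (fun x => Num.sqrt (f x)).
Proof.
move=> oA f0; elim: k => [|k IH] Cf; split=> //.
1, 2: by move=> x Ax; have [cf _] := Cf;
  exact: (continuous_comp (cf x Ax) (@sqrt_continuous R _)).
move=> v; have [_ /(_ v)[dfv Cdf]] := Cf.
have dsq x : A x -> is_derive (0 : R) (1 : R) (fun t : R => Num.sqrt (real_line f x v t))
    ((2 * Num.sqrt (f x))^-1 * rderive v f x).
  move=> Ax; rewrite -{1}(real_line0 f x v).
  have dl : is_derive (0 : R) (1 : R) (real_line f x v) (rderive v f x).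
    exact: DeriveDef (dfv x Ax) _.
  apply: is_derive1_comp.
  by apply: is_derive1_sqrt; rewrite real_line0; exact: f0.
split; first by move=> x Ax; have [] := dsq x Ax.
have CS := IH (CkS Cf).
have CI : Ck k A (fun x => (2 * Num.sqrt (f x))^-1).
  apply: CkV (CkM oA (Ck_cst k A 2) CS) => // x Ax.
  by rewrite mulf_neq0// gt_eqF// sqrtr_gt0 f0.
apply: Ck_ext (CkM oA CI Cdf) => // x Ax.
by have [_ dE] := dsq x Ax; exact: esym dE.
Qed.

Lemma smooth_on_ext A f g : open A -> (forall y, A y -> f y = g y) ->
  smooth_on A f -> smooth_on A g.
Proof. by move=> oA fg Cf k; exact: Ck_ext (Cf k). Qed.

Lemma smooth_on_cst A (c : R) : smooth_on A (fun=> c).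
Proof. by move=> k; exact: Ck_cst. Qed.

Lemma smooth_onD A f g : open A -> smooth_on A f -> smooth_on A g ->
  smooth_on A (fun x => f x + g x).
Proof. by move=> oA Cf Cg k; exact: CkD. Qed.

Lemma smooth_onM A f g : open A -> smooth_on A f -> smooth_on A g ->
  smooth_on A (fun x => f x * g x).
Proof. by move=> oA Cf Cg k; exact: CkM. Qed.

Lemma smooth_onN A f : open A -> smooth_on A f -> smooth_on A (fun x => - f x).
Proof.
move=> oA Cf; apply: smooth_on_ext (smooth_onM oA (smooth_on_cst A (-1)) Cf) => //.
by move=> x _; rewrite mulN1r.
Qed.

Lemma smooth_onB A f g : open A -> smooth_on A f -> smooth_on A g ->
  smooth_on A (fun x => f x - g x).
Proof. by move=> oA Cf Cg; exact: smooth_onD (smooth_onN _ _). Qed.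

Lemma smooth_onV A f : open A -> (forall x, A x -> f x != 0) ->
  smooth_on A f -> smooth_on A (fun x => (f x)^-1).
Proof. by move=> oA f0 Cf k; exact: CkV. Qed.

Lemma smooth_on_sqrt A f : open A -> (forall x, A x -> 0 < f x) ->
  smooth_on A f -> smooth_on A (fun x => Num.sqrt (f x)).
Proof. by move=> oA f0 Cf k; exact: Ck_sqrt. Qed.

Implicit Types (u w : X -> Cx R).

Lemma csmooth_on_ext A u w : open A -> (forall y, A y -> u y = w y) ->
  csmooth_on A u -> csmooth_on A w.
Proof.
move=> oA uw [sr si].
by split; [apply: smooth_on_ext sr|apply: smooth_on_ext si] => // y /uw ->.
Qed.

Lemma csmooth_on_real A f : smooth_on A f ->
  csmooth_on A (fun x => (f x)%:C%C : Cx R).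
Proof. by move=> sf; split=> //=; exact: smooth_on_cst. Qed.

Lemma csmooth_on_cst A (c : Cx R) : csmooth_on A (fun=> c).
Proof. by split; exact: smooth_on_cst. Qed.

Lemma csmooth_onD A u w : open A -> csmooth_on A u -> csmooth_on A w ->
  csmooth_on A (fun x => u x + w x).
Proof.
move=> oA [ur ui] [wr wi].
split; [apply: smooth_on_ext (smooth_onD oA ur wr)|
        apply: smooth_on_ext (smooth_onD oA ui wi)] => // x _.
1, 2: by case: (u x) (w x) => [a b] [c d].
Qed.

Lemma csmooth_onM A u w : open A -> csmooth_on A u -> csmooth_on A w ->
  csmooth_on A (fun x => u x * w x).
Proof.
move=> oA [ur ui] [wr wi].
split; [apply: smooth_on_ext
          (smooth_onB oA (smooth_onM oA ur wr) (smooth_onM oA ui wi))|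
        apply: smooth_on_ext
          (smooth_onD oA (smooth_onM oA ur wi) (smooth_onM oA ui wr))] => // x _.
1, 2: by case: (u x) (w x) => [a b] [c d].
Qed.

Lemma csmooth_on_conj A u : open A -> csmooth_on A u ->
  csmooth_on A (fun x => (u x)^*).
Proof.
move=> oA [ur ui].
split; [apply: smooth_on_ext ur|
        apply: smooth_on_ext (smooth_onN oA ui)] => // x _.
1, 2: by case: (u x) => [a b].
Qed.

(** 1 / (p + iq) = (p - iq) / (p^2 + q^2), and the denominator vanishes only for p = q = 0. *)
Lemma csmooth_onV A u : open A -> (forall x, A x -> u x != 0) ->
  csmooth_on A u -> csmooth_on A (fun x => (u x)^-1).
Proof.
move=> oA u0 [ur ui].
have s2 := smooth_onD oA (smooth_onM oA ur ur) (smooth_onM oA ui ui).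
have sI : smooth_on A (fun x => (complex.Re (u x) * complex.Re (u x) +
    complex.Im (u x) * complex.Im (u x))^-1).
  apply: smooth_onV s2 => // x /u0; apply: contra => /eqP uu.
  move: uu; case: (u x) => [a b] /= /eqP.
  rewrite paddr_eq0 -?expr2 ?sqr_ge0// !sqrf_eq0 => /andP[/eqP -> /eqP ->].
  by [].
split; [apply: smooth_on_ext (smooth_onM oA ur sI)|
        apply: smooth_on_ext (smooth_onN oA (smooth_onM oA ui sI))] => // x _.
1, 2: by case: (u x) => [a b] /=; rewrite !expr2.
Qed.

Lemma csmooth_on_sum (I : Type) (s : seq I) (P : pred I) A
    (u : I -> X -> Cx R) : open A -> (forall i, csmooth_on A (u i)) ->
  csmooth_on A (fun x => \sum_(i <- s | P i) u i x).
Proof.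
move=> oA su; elim: s => [|i s IH].
  apply: csmooth_on_ext (csmooth_on_cst A 0) => // x _.
  by rewrite big_nil.
case Pi : (P i); last first.
  by apply: csmooth_on_ext IH => // x _; rewrite big_cons Pi.
by apply: csmooth_on_ext (csmooth_onD oA (su i) IH) => // x _; rewrite big_cons Pi.
Qed.

Lemma csmooth_on_prod (I : Type) (s : seq I) (P : pred I) A
    (u : I -> X -> Cx R) : open A -> (forall i, csmooth_on A (u i)) ->
  csmooth_on A (fun x => \prod_(i <- s | P i) u i x).
Proof.
move=> oA su; elim: s => [|i s IH].
  apply: csmooth_on_ext (csmooth_on_cst A 1) => // x _.
  by rewrite big_nil.
case Pi : (P i); last first.
  by apply: csmooth_on_ext IH => // x _; rewrite big_cons Pi.
by apply: csmooth_on_ext (csmooth_onM oA (su i) IH) => // x _; rewrite big_cons Pi.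
Qed.

Lemma csmooth_on_det n A (G : X -> 'M[Cx R]_n) : open A ->
  (forall i j, csmooth_on A (fun x => G x i j)) ->
  csmooth_on A (fun x => \det (G x)).
Proof.
move=> oA sG; apply: csmooth_on_sum => // s.
by apply: csmooth_onM (csmooth_on_cst _ _) _ => //; exact: csmooth_on_prod.
Qed.

(** Cramer's rule: an entry of the inverse is a cofactor over the determinant, and both are
    polynomial in the entries of [G]. *)
Lemma csmooth_on_invmx n A (G : X -> 'M[Cx R]_n) : open A ->
  (forall x, A x -> G x \in unitmx) ->
  (forall i j, csmooth_on A (fun x => G x i j)) ->
  forall i j, csmooth_on A (fun x => invmx (G x) i j).
Proof.
move=> oA uG sG i j.
have sc : csmooth_on A (fun x => cofactor (G x) j i).
  apply: csmooth_onM (csmooth_on_cst _ _) _ => //.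
  apply: csmooth_on_det => // k l.
  by apply: csmooth_on_ext (sG (lift j k) (lift i l)) => // x _; rewrite !mxE.
apply: csmooth_on_ext (csmooth_onM oA (csmooth_onV oA _ (csmooth_on_det oA sG)) sc) => //.
by move=> x Ax; rewrite /invmx uG// !mxE.
Qed.

End Smoothness.

(** * Hermitian forms *)

Section HermitianForms.
Context {R : realType}.
Implicit Types (z : Cx R) (r s : R).

Definition toC r : Cx R := (r%:C)%C.

Lemma toCM r s : toC (r * s) = toC r * toC s.
Proof. by apply/eqP; rewrite eq_complex /= !mulr0 !mul0r subr0 addr0 !eqxx. Qed.

Lemma toCD r s : toC (r + s) = toC r + toC s.
Proof. by apply/eqP; rewrite eq_complex /= addr0 !eqxx. Qed.

Lemma toCN r : toC (- r) = - toC r.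
Proof. by apply/eqP; rewrite eq_complex /= oppr0 !eqxx. Qed.

Lemma toCB r s : toC (r - s) = toC r - toC s.
Proof. by rewrite toCD toCN. Qed.

Lemma toCV r : toC r^-1 = (toC r)^-1.
Proof. exact: (fmorphV (real_complex R)). Qed.

Lemma toC_inj : injective toC.
Proof. by move=> r s []. Qed.

Lemma conj_toC r : (toC r)^* = toC r.
Proof. by apply/eqP; rewrite eq_complex /= oppr0 !eqxx. Qed.

Lemma toC_gt0 r : (0 < toC r) = (0 < r).
Proof. exact: ltcR. Qed.

Lemma toC_eq0 r : (toC r == 0) = (r == 0).
Proof. by rewrite eq_complex /= eqxx andbT. Qed.

Lemma toC_cmod z : toC (cmod z) = `|z|.
Proof. by rewrite /cmod /toC normc_def. Qed.

Lemma cmodM z z' : cmod (z * z') = cmod z * cmod z'.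
Proof. by apply: toC_inj; rewrite toCM !toC_cmod normrM. Qed.

Lemma cmod_toC r : 0 <= r -> cmod (toC r) = r.
Proof.
by move=> r0; rewrite /cmod normc_def /= expr0n addr0 sqrtr_sqr ger0_norm.
Qed.

Lemma toC_cmod2 z : toC (cmod z ^+ 2) = z * z^*.
Proof. by rewrite expr2 toCM toC_cmod -expr2 normCK. Qed.

Context {n : nat}.
Implicit Types (G : 'M[Cx R]_n) (v w b X : 'rV[Cx R]_n).

Definition conj_row v : 'rV[Cx R]_n := \row_j (v 0 j)^*.

Lemma pairingE b v : pairing b v = (v *m b^T) 0 0.
Proof. by rewrite mxE; apply: eq_bigr => i _; rewrite mxE mulrC. Qed.

Lemma hformE G v w : hform G v w = (v *m G *m (conj_row w)^T) 0 0.
Proof.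
rewrite /hform exchange_big mxE; apply: eq_bigr => j _ /=.
by rewrite !mxE mulr_suml; apply: eq_bigr => i _; rewrite (mulrC (G i j)).
Qed.

(* [flat G X] is the (1,0)-form v |-> G(v, conj X). *)
Definition flat G X : 'rV[Cx R]_n := conj_row X *m G^T.
(** Solves conj(X) G^T = b for X, which makes it the inverse of [flat G] for invertible [G]. *)
Definition sharp G b : 'rV[Cx R]_n := conj_row (b *m invmx G^T).
(** The matrix of the rank one Hermitian form b (x) conj b. *)
Definition outer b : 'M[Cx R]_n := b^T *m conj_row b.

Lemma conj_rowK : involutive conj_row.
Proof. by move=> v; apply/rowP => j; rewrite !mxE conjCK. Qed.

Lemma conj_rowZ z v : conj_row (z *: v) = z^* *: conj_row v.
Proof. by apply/rowP => j; rewrite !mxE rmorphM. Qed.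

Lemma conj_rowD v w : conj_row (v + w) = conj_row v + conj_row w.
Proof. by apply/rowP => j; rewrite !mxE rmorphD. Qed.

Lemma conj_row_sum (I : finType) (v : I -> 'rV[Cx R]_n) :
  conj_row (\sum_i v i) = \sum_i conj_row (v i).
Proof.
by apply/rowP => j; rewrite !(mxE, summxE) rmorph_sum; apply: eq_bigr => i _; rewrite mxE.
Qed.

Lemma pairingZr z b v : pairing b (z *: v) = z * pairing b v.
Proof. by rewrite !pairingE -scalemxAl mxE. Qed.

Lemma pairing_flat G X v : pairing (flat G X) v = hform G v X.
Proof. by rewrite pairingE hformE /flat trmx_mul trmxK mulmxA. Qed.

Lemma flat_sharp G b : G \in unitmx -> flat G (sharp G b) = b.
Proof.
by move=> uG; rewrite /flat /sharp conj_rowK mulmxKV// unitmx_tr.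
Qed.

Lemma flatK G : G \in unitmx -> cancel (flat G) (sharp G).
Proof.
by move=> uG X; rewrite /flat /sharp mulmxK ?conj_rowK// unitmx_tr.
Qed.

Lemma pairingZl z b v : pairing (z *: b) v = z * pairing b v.
Proof. by rewrite !pairingE linearZ/= -scalemxAr mxE. Qed.

Lemma pairing_delta b i : pairing b (delta_mx 0 i) = b 0 i.
Proof. by rewrite pairingE -rowE !mxE. Qed.

Lemma pairing_inj b b' : (forall v, pairing b v = pairing b' v) -> b = b'.
Proof. by move=> bb'; apply/rowP => i; rewrite -!pairing_delta. Qed.

Lemma pairing_sumr (I : finType) b (v : I -> 'rV[Cx R]_n) :
  pairing b (\sum_i v i) = \sum_i pairing b (v i).
Proof.
by rewrite pairingE mulmx_suml summxE; apply: eq_bigr => i _; rewrite pairingE.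
Qed.

Lemma hformZl G z v w : hform G (z *: v) w = z * hform G v w.
Proof. by rewrite -!pairing_flat pairingZr. Qed.

Lemma hformZr G z v w : hform G v (z *: w) = z^* * hform G v w.
Proof. by rewrite !hformE conj_rowZ linearZ/= -scalemxAr mxE. Qed.

Lemma hformDl G v v' w : hform G (v + v') w = hform G v w + hform G v' w.
Proof. by rewrite !hformE !mulmxDl mxE. Qed.

Lemma hformDr G v w w' : hform G v (w + w') = hform G v w + hform G v w'.
Proof. by rewrite !hformE conj_rowD linearD/= mulmxDr mxE. Qed.

Lemma hform_suml (I : finType) G (v : I -> 'rV[Cx R]_n) w :
  hform G (\sum_i v i) w = \sum_i hform G (v i) w.
Proof. by rewrite -pairing_flat pairing_sumr; apply: eq_bigr => i _; rewrite pairing_flat. Qed.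

Lemma hform_sumr (I : finType) G v (w : I -> 'rV[Cx R]_n) :
  hform G v (\sum_i w i) = \sum_i hform G v (w i).
Proof.
rewrite hformE conj_row_sum linear_sum/= mulmx_sumr summxE.
by apply: eq_bigr => i _; rewrite hformE.
Qed.

(** Both passages, from Randers data to navigation data and back, change the metric by a rank one
    term of this shape. *)
Lemma hform_rank1 G b z z' v w :
  hform (z *: G + z' *: outer b) v w =
  z * hform G v w + z' * (pairing b v * (pairing b w)^*).
Proof.
rewrite !hformE !mulmxDr mulmxDl mxE -!scalemxAr -!scalemxAl [in LHS]mxE.
congr (_ + _); rewrite mxE; congr (_ * _).
(* The product [v *m b^T] is a 1 by 1 matrix, so multiplying by it is scaling by b(v). *)
rewrite -pairingE /outer mulmxA [v *m _]mx11_scalar mul_scalar_mx pairingZr -pairingE.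
congr (_ * _); rewrite rmorph_sum; apply: eq_bigr => i _.
by rewrite !mxE rmorphM mulrC.
Qed.

Lemma hermitian_rank1 G b r s : (forall i j, G j i = (G i j)^*) ->
  forall i j, (toC r *: G + toC s *: outer b) j i =
              ((toC r *: G + toC s *: outer b) i j)^*.
Proof.
move=> HG i j; rewrite !mxE !big_ord1 !mxE rmorphD !rmorphM /= !conj_toC conjCK -HG.
by rewrite (mulrC (b 0 j)).
Qed.

Lemma hform_conj G v w : (forall i j, G j i = (G i j)^*) ->
  hform G w v = (hform G v w)^*.
Proof.
move=> HG; rewrite /hform exchange_big rmorph_sum; apply: eq_bigr => i _ /=.
rewrite rmorph_sum; apply: eq_bigr => j _.
by rewrite !rmorphM /= conjCK HG mulrAC.
Qed.

Lemma posdef_unitmx G : posdef G -> G \in unitmx.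
Proof.
move=> pG; rewrite unitmxE unitfE; apply/det0P => -[v v0 vG].
by have := pG v v0; rewrite hformE vG mul0mx mxE ltxx.
Qed.

(** Being nonnegative in [Cx R], the value on the diagonal is real, so the real part taken in
    [hnorm] loses nothing. *)
Lemma hform_hnorm G v : posdef G -> hform G v v = toC (hnorm G v ^+ 2).
Proof.
move=> pG; have hv : 0 <= hform G v v.
  have [->|v0] := eqVneq v 0; first by rewrite hformE !mul0mx mxE.
  exact/ltW/pG.
have hE : toC (complex.Re (hform G v v)) = hform G v v.
  by apply: RRe_real; exact: ger0_real.
by rewrite sqr_sqrtr// -(lecR _ (complex.Re _)) [X in _ <= X]hE.
Qed.

Lemma hnorm_ge0 G v : 0 <= hnorm G v.
Proof. exact: sqrtr_ge0. Qed.

Lemma hnorm0 G : hnorm G 0 = 0.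
Proof. by rewrite /hnorm hformE !mul0mx mxE sqrtr0. Qed.

Lemma hnorm_gt0 G v : posdef G -> (0 < hnorm G v) = (v != 0).
Proof.
move=> pG; rewrite lt_def hnorm_ge0 andbT; congr (~~ _).
apply/eqP/eqP => [hv|->]; last by rewrite /hnorm hformE !mul0mx mxE sqrtr0.
apply/eqP/negPn/negP => /pG.
by rewrite hform_hnorm// hv expr0n /= ltxx.
Qed.

(** Contracting b = [flat G X] with the inverse matrix gives back conj X, so the double sum
    collapses to the conjugate of b(X) = G(X, conj X), a real number. *)
Lemma conorm2_flat G X : posdef G -> conorm2 G (flat G X) = hnorm G X ^+ 2.
Proof.
move=> pG; have uG := posdef_unitmx pG.
suff -> : conorm2 G (flat G X) = complex.Re ((pairing (flat G X) X)^*).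
  by rewrite pairing_flat hform_hnorm// conj_toC.
have -> : (pairing (flat G X) X)^* = pairing (conj_row (flat G X)) (conj_row X).
  by rewrite rmorph_sum; apply: eq_bigr => i _; rewrite rmorphM !mxE.
have -> : conj_row X = flat G X *m (invmx G)^T.
  by rewrite /flat trmx_inv mulmxK// unitmx_tr.
congr (complex.Re _); rewrite exchange_big; apply: eq_bigr => j _ /=.
rewrite mulrC [in RHS]mxE mulr_suml; apply: eq_bigr => i _.
by rewrite [conj_row _ 0 j]mxE [(invmx G)^T i j]mxE [invmx G j i * _]mulrC.
Qed.

Lemma hnormZ G r v : 0 <= r -> hnorm G (toC r *: v) = r * hnorm G v.
Proof.
move=> r0; rewrite /hnorm hformZl hformZr conj_toC mulrA -toCM -expr2.
rewrite [X in Num.sqrt X](_ : _ = r ^+ 2 * complex.Re (hform G v v)).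
  by rewrite sqrtrM ?sqr_ge0// sqrtr_sqr ger0_norm.
by case: (hform G v v) => x y /=; rewrite mul0r subr0.
Qed.

Lemma hform_rank1_diag G b r s v : posdef G ->
  hform (toC r *: G + toC s *: outer b) v v =
  toC (r * hnorm G v ^+ 2 + s * cmod (pairing b v) ^+ 2).
Proof. by move=> pG; rewrite hform_rank1 hform_hnorm// -toC_cmod2 toCD !toCM. Qed.

Lemma hnorm_rank1 G b r s v : posdef G ->
  hnorm (toC r *: G + toC s *: outer b) v =
  Num.sqrt (r * hnorm G v ^+ 2 + s * cmod (pairing b v) ^+ 2).
Proof. by move=> pG; rewrite {1}/hnorm hform_rank1_diag. Qed.

Lemma hform_scale G z v w : hform (z *: G) v w = z * hform G v w.
Proof. by rewrite !hformE -scalemxAr -scalemxAl mxE. Qed.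

(** Serves to absorb a conformal factor into the metric. *)
Lemma hnorm_scale G r v : 0 <= r ->
  hnorm (toC (r ^+ 2) *: G) v = r * hnorm G v.
Proof.
move=> r0; rewrite -hnormZ// /hnorm hform_scale hformZl hformZr conj_toC.
by rewrite mulrA -toCM expr2.
Qed.

Lemma posdef_rank1 G b r s : 0 < r -> 0 <= s -> posdef G ->
  posdef (toC r *: G + toC s *: outer b).
Proof.
move=> r0 s0 pG v v0; rewrite hform_rank1_diag// toC_gt0 ltr_pwDl//.
  by rewrite mulr_gt0// exprn_gt0// hnorm_gt0.
by rewrite mulr_ge0// sqr_ge0.
Qed.

Lemma cauchy_schwarz G v X : (forall i j, G j i = (G i j)^*) -> posdef G ->
  cmod (hform G v X) ^+ 2 <= hnorm G X ^+ 2 * hnorm G v ^+ 2.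
Proof.
move=> HG pG; have [->|X0] := eqVneq X 0.
  by rewrite -(scale0r 0) hformZr rmorph0 mul0r (cmod_toC (lexx 0))
    expr0n mulr_ge0 ?sqr_ge0.
set B := hnorm G X ^+ 2; have B0 : 0 < B by rewrite exprn_gt0 ?hnorm_gt0.
(* With this [t] the vector [v + t *: X] is the component of [v] orthogonal to [X]; its squared norm
   is that of [v] minus |G(v, conj X)|^2 / B. *)
pose t : Cx R := - (toC B^-1 * hform G v X).
have := sqr_ge0 (hnorm G (v + t *: X)).
have -> : hnorm G (v + t *: X) ^+ 2 =
          hnorm G v ^+ 2 - B^-1 * cmod (hform G v X) ^+ 2.
  apply: toC_inj; rewrite -hform_hnorm// hformDl !hformDr !hformZl !hformZr.
  rewrite (hform_conj v X HG) !hform_hnorm// -/B /t.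
  rewrite !rmorphN !rmorphM /= conj_toC.
  set z := hform G v X.
  rewrite toCB [toC (B^-1 * _)]toCM toC_cmod2 toCV.
  have BC0 : toC B != 0 by rewrite toC_eq0 gt_eqF.
  field.
  exact: BC0.
by rewrite subr_ge0 mulrC ler_pdivrMr// mulrC.
Qed.

(** * From Randers data to navigation data in a single tangent space *)

Section RandersToZermelo.
Variables (G : 'M[Cx R]_n) (b X : 'rV[Cx R]_n) (B : R).
Hypothesis HG : forall i j, G j i = (G i j)^*.
Hypothesis pG : posdef G.
Hypothesis bX : forall v, hform G v X = pairing b v.
Hypothesis BE : hnorm G X ^+ 2 = B.
Hypothesis B01 : 0 < B < 1.

Let h := toC (1 - B) *: G + toC (- (1 - B)) *: outer b.
Let W := toC (1 - B)^-1 *: X.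

Lemma cauchy_schwarz_form v : cmod (pairing b v) ^+ 2 <= B * hnorm G v ^+ 2.
Proof. by rewrite -bX -BE; exact: cauchy_schwarz. Qed.

(** The rank one coefficient is negative here; Cauchy-Schwarz with B < 1 gives |b(v)|^2 < G(v, conj
    v) for v nonzero. *)
Lemma zermelo_posdef : posdef h.
Proof.
move=> v v0; rewrite hform_rank1_diag// toC_gt0.
have v2 : 0 < hnorm G v ^+ 2 by rewrite exprn_gt0 ?hnorm_gt0.
have /andP[_ B1] := B01; rewrite mulNr -mulrBr mulr_gt0 ?subr_gt0//.
by rewrite (le_lt_trans (cauchy_schwarz_form v))// gtr_pMl.
Qed.

(** The factor 1 - B of [h] cancels against that of [W], leaving G(v, conj X) - b(v) conj b(X) =
    b(v) - B b(v), as b(X) = B is real. *)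
Lemma zermelo_hformW v : hform h v W = toC (1 - B) * pairing b v.
Proof.
have /andP[B0 B1] := B01.
have b1 : toC (1 - B) != 0 by rewrite toC_eq0; apply/eqP; lra.
rewrite hformZr conj_toC hform_rank1 bX -[pairing b X]bX hform_hnorm// BE conj_toC.
rewrite toCN; have -> : toC B = 1 - toC (1 - B) by rewrite toCB opprB addrC subrK.
by rewrite toCV; move: (toC (1 - B)) b1 => u u0; field.
Qed.

Lemma zermelo_hnormW : hnorm h W ^+ 2 = B.
Proof.
have /andP[B0 B1] := B01.
have b1 : toC (1 - B) != 0 by rewrite toC_eq0; apply/eqP; lra.
apply: toC_inj; rewrite -hform_hnorm; last exact: zermelo_posdef.
rewrite zermelo_hformW /W pairingZr -bX hform_hnorm// BE toCV.
by rewrite mulrA mulfV// mul1r.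
Qed.

(** Since eps = 1 - B, the |b(v)|^2 terms cancel and the radicand is the square of (1 - B)
    [hnorm G v]. The factors [-1] and [1 ^+ 2] are kept to match [nav_formula] for cos phi = -1 and
    unit speed. *)
Lemma zermelo_solution v :
  (Num.sqrt (cmod (hform h v W) ^+ 2 * (-1) ^+ 2 +
             hnorm h v ^+ 2 * (1 ^+ 2 - hnorm h W ^+ 2))
   - cmod (hform h v W) * -1) / (1 ^+ 2 - hnorm h W ^+ 2) =
  hnorm G v + cmod (pairing b v).
Proof.
have /andP[B0 B1] := B01.
rewrite zermelo_hnormW zermelo_hformW cmodM cmod_toC ?subr_ge0 ?ltW//.
rewrite hnorm_rank1// sqr_sqrtr; last first.
  rewrite mulNr -mulrBr; apply: mulr_ge0; rewrite subr_ge0 ?(ltW B1)//.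
  by rewrite (le_trans (cauchy_schwarz_form v))// ler_piMl ?sqr_ge0 ?ltW.
set c := cmod _; set s := hnorm G v.
have -> : ((1 - B) * c) ^+ 2 * (-1) ^+ 2 +
    ((1 - B) * s ^+ 2 + - (1 - B) * c ^+ 2) * (1 ^+ 2 - B) = ((1 - B) * s) ^+ 2.
  by ring.
rewrite sqrtr_sqr ger0_norm ?mulr_ge0 ?hnorm_ge0 ?subr_ge0 ?ltW//.
field; by apply/eqP; lra.
Qed.

End RandersToZermelo.

(** * From navigation data to Randers data in a single tangent space *)

Section ZermeloToRanders.
Variables (h : 'M[Cx R]_n) (W : 'rV[Cx R]_n) (f : R).
Hypothesis ph : posdef h.
Hypothesis Wf : hnorm h W < f.

Let eps := f ^+ 2 - hnorm h W ^+ 2.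
Let b := toC eps^-1 *: flat h W.
(** The explicit coefficient [toC 1] keeps [a] in the form treated by the rank one lemmas. *)
Let a := toC eps^-1 *: h + toC 1 *: outer b.

Lemma eps_gt0 : 0 < eps.
Proof.
by have f0 := le_lt_trans (hnorm_ge0 h W) Wf; rewrite subr_gt0 ltr_pXn2r// nnegrE ?hnorm_ge0 ?(ltW f0).
Qed.

Lemma randers_posdef : posdef a.
Proof. by apply: posdef_rank1 => //; rewrite invr_gt0 eps_gt0. Qed.

Lemma randers_hform v w : hform a v w =
  toC eps^-1 * hform h v w + pairing b v * (pairing b w)^*.
Proof. by rewrite hform_rank1 mul1r. Qed.

Lemma randers_pairing v : pairing b v = toC eps^-1 * hform h v W.
Proof. by rewrite pairingZl pairing_flat. Qed.

Hypothesis W0 : 0 < hnorm h W.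

(** As eps + ||W||^2 = f^2, one finds a(v, conj W) = (1/eps + ||W||^2/eps^2) h(v, conj W) =
    (f^2/eps^2) h(v, conj W); scaling [W] by eps/f^2 turns this into b(v). *)
Lemma randers_flat : b = flat a (toC (eps / f ^+ 2) *: W).
Proof.
have e0 := eps_gt0.
have f0 : 0 < f by rewrite (lt_trans W0).
apply: pairing_inj => v.
rewrite pairing_flat hformZr conj_toC randers_hform !randers_pairing.
rewrite hform_hnorm// rmorphM /= !conj_toC.
have -> : hnorm h W ^+ 2 = f ^+ 2 - eps by rewrite /eps; lra.
have e0C : toC eps != 0 by rewrite toC_eq0 gt_eqF.
have f0C : toC (f ^+ 2) != 0 by rewrite toC_eq0 gt_eqF ?exprn_gt0.
rewrite toCB [toC (eps / _)]toCM !toCV.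
by move: (toC eps) (toC (f ^+ 2)) e0C f0C => x y x0 y0; field; rewrite x0 y0.
Qed.

Lemma randers_conorm2 : conorm2 a b = hnorm h W ^+ 2 / f ^+ 2.
Proof.
have e0 := eps_gt0.
have f0 : 0 < f by rewrite (lt_trans W0).
rewrite {1}randers_flat conorm2_flat; last exact: randers_posdef.
apply: toC_inj; rewrite -hform_hnorm; last exact: randers_posdef.
(* Going back to the pairing with [b] reduces the norm to (eps/f^2) b(W), where b(W) = ||W||^2/eps,
   without expanding [a]. *)
rewrite -pairing_flat -randers_flat pairingZr randers_pairing hform_hnorm// -!toCM.
congr toC; field; rewrite !gt_eqF//.
Qed.

Lemma randers_conorm2_lt1 : 0 < conorm2 a b < 1.
Proof.
have f2 : 0 < f ^+ 2 by rewrite exprn_gt0// (lt_trans W0).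
rewrite randers_conorm2; apply/andP; split; first by apply: divr_gt0 => //; exact: exprn_gt0.
rewrite ltr_pdivrMr// mul1r.
by have := eps_gt0; rewrite subr_gt0.
Qed.

(** The factor 1/eps^2 comes out of the radicand: s^2/eps + (c/eps)^2 = (c^2 + s^2 eps)/eps^2. *)
Lemma randers_solution v : hnorm a v + cmod (pairing b v) =
  (Num.sqrt (cmod (hform h v W) ^+ 2 * (-1) ^+ 2 + hnorm h v ^+ 2 * eps)
   - cmod (hform h v W) * -1) / eps.
Proof.
have e0 := eps_gt0; have e1 : eps != 0 by rewrite gt_eqF.
rewrite hnorm_rank1// randers_pairing cmodM cmod_toC ?invr_ge0 ?ltW//.
set c := cmod _; set s := hnorm h v.
rewrite mulrN1 opprK mulrDl [c / eps]mulrC; congr (_ + _).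
set T := c ^+ 2 * _ + _; have T0 : 0 <= T.
  by rewrite addr_ge0// mulr_ge0 ?sqr_ge0// ltW.
have -> : eps^-1 * s ^+ 2 + 1 * (eps^-1 * c) ^+ 2 = T * (eps^-1) ^+ 2.
  by rewrite /T; field.
by rewrite sqrtrM// sqrtr_sqr ger0_norm// invr_ge0 ltW.
Qed.

End ZermeloToRanders.

End HermitianForms.

(** * Tensors in charts *)

(* [coord] is shadowed by the coordinates of vector.v. *)
Local Notation coord := Defs.coord.

(** Chain rule applied to [g \o f], which is the identity near [x]. *)
Lemma diff_local_inverse (K : numFieldType) (U V : normedModType K)
    (f : U -> V) (g : V -> U) (x v : U) :
  differentiable f x -> differentiable g (f x) ->
  (\forall y \near x, g (f y) = y) -> 'd g (f x) ('d f x v) = v.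
Proof.
move=> df dg gf.
have dgf := diff_comp df dg.
have E : 'd (g \o f) x v = 'd g (f x) ('d f x v) by rewrite dgf.
rewrite -E -(deriveE v (differentiable_comp df dg)).
by rewrite (@near_eq_derive K U U (g \o f) id x v gf) derive_id.
Qed.

Section Charts.
Context {R : realType} {n : nat} {M : complex_manifold R n}.
Local Notation C := (Cx R).
Implicit Types (c d : chart M) (p : M) (v : 'rV[C]_n).

Lemma open_chart_image c : open (chart_image c).
Proof. exact: image_open. Qed.

Lemma chart_image_dom c x : chart_image c x ->
  dom c (param c x) /\ coord c (param c x) = x.
Proof. by move=> [p cp <-]; rewrite coordK. Qed.

Lemma transitionK c d p v : dom c p -> dom d p ->
  'd (coord c \o param d) (coord d p)
    ('d (coord d \o param c) (coord c p) v) = v.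
Proof.
move=> cp dp.
have df : differentiable (coord d \o param c) (coord c p).
  by apply: transition_holomorphic; exists p.
have fp : (coord d \o param c) (coord c p) = coord d p by rewrite /= coordK.
have dg : differentiable (coord c \o param d) (coord d p).
  by apply: transition_holomorphic; exists p.
(* The transition maps are mutually inverse only over the overlap of the two charts, which contains
   all points near p because the domains and images are open and [param c] is continuous. *)
have gf : \forall x \near coord c p,
    (coord c \o param d) ((coord d \o param c) x) = x.
  near=> x.
  have cx : chart_image c x.
    by near: x; apply: open_nbhs_nbhs; split; [exact: image_open|exists p].
  have dx : dom d (param c x).
    near: x; apply: (param_cts (c := c)); first by exists p.
    by apply: open_nbhs_nbhs; split; [exact: dom_open|rewrite coordK].
  by rewrite /= coordK//; have [] := chart_image_dom cx.
move: (coord d \o param c) (coord c \o param d) df fp dg gf => f g df <- dg gf.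
have fgK := diff_local_inverse v df dg gf.
exact: fgK.
Unshelve. all: by end_near. Qed.

Lemma from_chartK c p : dom c p -> cancel (to_chart c p) (from_chart c p).
Proof. by move=> cp v; apply: transitionK => //; exact: mem_chart_at. Qed.

Lemma to_chartK c p : dom c p -> cancel (from_chart c p) (to_chart c p).
Proof. by move=> cp v; apply: transitionK => //; exact: mem_chart_at. Qed.

Lemma from_chart_sum c p v :
  from_chart c p v = \sum_k v 0 k *: coord_vector c p k.
Proof.
rewrite {1}[v]row_sum_delta /from_chart linear_sum.
by apply: eq_bigr => k _; rewrite linearZ.
Qed.

Lemma chart_expansion c p v : dom c p ->
  v = \sum_k to_chart c p v 0 k *: coord_vector c p k.
Proof. by move=> cp; rewrite -from_chart_sum from_chartK. Qed.

Lemma to_chartZ c p z v : to_chart c p (z *: v) = z *: to_chart c p v.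
Proof. by rewrite /to_chart linearZ. Qed.

Lemma to_chart0 c p : to_chart c p 0 = 0.
Proof. by rewrite /to_chart linear0. Qed.

End Charts.

Arguments open_chart_image {R n M} c _ _.

(** * Smoothness of contractions, of rank one changes of metric, and of dual fields *)

Section SmoothTensors.
Context {R : realType} {n : nat} {M : complex_manifold R n}.
Local Notation C := (Cx R).
Implicit Types (r s f : M -> R) (b W : M -> 'rV[C]_n) (h : M -> 'M[C]_n).

Local Notation oc := open_chart_image.

Definition csmooth_function (g : M -> C) : Prop :=
  forall c, csmooth_on (chart_image c) (g \o param c).

Lemma smooth_function_cst (k : R) : smooth_function (fun _ : M => k).
Proof. by move=> c; exact: smooth_on_cst. Qed.

Lemma smooth_functionM r s : smooth_function r -> smooth_function s ->
  smooth_function (fun p => r p * s p).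
Proof. by move=> sr ss c; exact: smooth_onM (oc c) (sr c) (ss c). Qed.

Lemma smooth_functionN r : smooth_function r -> smooth_function (fun p => - r p).
Proof. by move=> sr c; exact: smooth_onN (oc c) (sr c). Qed.

Lemma smooth_functionB r s : smooth_function r -> smooth_function s ->
  smooth_function (fun p => r p - s p).
Proof. by move=> sr ss c; exact: smooth_onB (oc c) (sr c) (ss c). Qed.

Lemma smooth_functionV r : (forall p, 0 < r p) -> smooth_function r ->
  smooth_function (fun p => (r p)^-1).
Proof.
by move=> r0 sr c; apply: (smooth_onV (oc c) _ (sr c)) => x _; exact/lt0r_neq0/r0.
Qed.

Lemma smooth_function_sqrt r : (forall p, 0 < r p) -> smooth_function r ->
  smooth_function (fun p => Num.sqrt (r p)).
Proof.
by move=> r0 sr c; apply: (smooth_on_sqrt (oc c) _ (sr c)) => x _; exact: r0.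
Qed.

Lemma smooth_formZ r b : smooth_function r -> smooth_form b ->
  smooth_form (fun p => toC (r p) *: b p).
Proof.
move=> sr sb c k.
apply: csmooth_on_ext (oc c) _ (csmooth_onM (oc c) (csmooth_on_real (sr c)) (sb c k)) => //.
move=> x _; exact/esym/pairingZl.
Qed.

Lemma smooth_vector_fieldZ r W : smooth_function r -> smooth_vector_field W ->
  smooth_vector_field (fun p => toC (r p) *: W p).
Proof.
move=> sr sW c k.
apply: csmooth_on_ext (oc c) _ (csmooth_onM (oc c) (csmooth_on_real (sr c)) (sW c k)) => //.
by move=> x _ /=; rewrite to_chartZ mxE.
Qed.

Lemma smooth_vector_field0 : smooth_vector_field (fun _ : M => (0 : 'rV[C]_n)).
Proof.
move=> c k; apply: csmooth_on_ext (oc c) _ (csmooth_on_cst _ 0) => // x _ /=.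
by rewrite to_chart0 mxE.
Qed.

(** Components in [chart_at] may jump, so the contraction is rewritten as the sum of products of
    components in the fixed chart [c]. *)
Lemma csmooth_pairing b W : smooth_form b -> smooth_vector_field W ->
  csmooth_function (fun p => pairing (b p) (W p)).
Proof.
move=> sb sW c.
apply: csmooth_on_ext (oc c) _ (csmooth_on_sum (index_enum 'I_n) xpredT (oc c)
  (fun k => csmooth_onM (oc c) (sW c k) (sb c k))) => // x cx /=.
have [dx _] := chart_image_dom cx.
rewrite [in RHS](chart_expansion (W (param c x)) dx) pairing_sumr.
by apply: eq_bigr => k _; rewrite pairingZr.
Qed.

Lemma smooth_flat h W : hermitian_metric h -> smooth_vector_field W ->
  smooth_form (fun p => flat (h p) (W p)).
Proof.
move=> [_ _ sh] sW c k.
apply: csmooth_on_ext (oc c) _ (csmooth_on_sum (index_enum 'I_n) xpredT (oc c)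
  (fun l => csmooth_onM (oc c) (csmooth_on_conj (oc c) (sW c l)) (sh c k l))) => // x cx /=.
have [dx _] := chart_image_dom cx.
rewrite pairing_flat [in RHS](chart_expansion (W (param c x)) dx) hform_sumr.
by apply: eq_bigr => l _; rewrite hformZr.
Qed.

(** Stated for the square, since the norm itself can fail to be smooth at zeros of [W]. *)
Lemma smooth_hnorm2 h W : hermitian_metric h -> smooth_vector_field W ->
  smooth_function (fun p => hnorm (h p) (W p) ^+ 2).
Proof.
move=> hh sW c; have [_ ph _] := hh.
have [sr _] := csmooth_pairing (smooth_flat hh sW) sW c.
apply: smooth_on_ext (oc c) _ sr => // x _ /=.
by rewrite pairing_flat hform_hnorm.
Qed.

Lemma smooth_nav_eps h f W : navigation_data h f W ->
  smooth_function (nav_eps h f W).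
Proof.
move=> [hh sf sW _]; apply: smooth_functionB; last exact: smooth_hnorm2.
exact: smooth_functionM.
Qed.

(** Positivity is left as a hypothesis because its proof depends on the sign of [s]. *)
Lemma hermitian_metric_rank1 h b r s :
  hermitian_metric h -> smooth_form b -> smooth_function r ->
  smooth_function s ->
  (forall p, posdef (toC (r p) *: h p + toC (s p) *: outer (b p))) ->
  hermitian_metric (fun p => toC (r p) *: h p + toC (s p) *: outer (b p)).
Proof.
move=> [Hh _ sh] sb sr ss ph; split=> // [p i j|c k l].
  exact: hermitian_rank1.
have sbb := csmooth_onM (oc c) (sb c k) (csmooth_on_conj (oc c) (sb c l)).
apply: csmooth_on_ext (oc c) _ (csmooth_onD (oc c)
  (csmooth_onM (oc c) (csmooth_on_real (sr c)) (sh c k l))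
  (csmooth_onM (oc c) (csmooth_on_real (ss c)) sbb)) => // x _ /=.
by rewrite hform_rank1.
Qed.

Lemma hermitian_metricZ h r : hermitian_metric h -> smooth_function r ->
  (forall p, 0 < r p) -> hermitian_metric (fun p => toC (r p) *: h p).
Proof.
move=> hh sr r0; have [_ ph _] := hh.
have -> : (fun p => toC (r p) *: h p) =
          (fun p => toC (r p) *: h p + toC 0 *: outer (0 : 'rV[C]_n)).
  by apply/funext => p; rewrite scale0r addr0.
apply: (@hermitian_metric_rank1 h (fun=> 0) r (fun=> 0)) => //.
- move=> c k; apply: csmooth_on_ext (oc c) _ (csmooth_on_cst _ 0) => // x _ /=.
  by rewrite -[X in pairing X _](scale0r 0) pairingZl mul0r.
- exact: smooth_function_cst.
- by move=> p; exact: posdef_rank1.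
Qed.

(** In the chart [c] the dual field is computed by the inverse of the matrix [A] of [h] in the
    coordinate frame, which is smooth by Cramer's rule. *)
Lemma smooth_sharp h b : hermitian_metric h -> smooth_form b ->
  smooth_vector_field (fun p => sharp (h p) (b p)).
Proof.
move=> [Hh ph sh] sb c k.
pose A x : 'M[C]_n := \matrix_(i, j)
  hform (h (param c x)) (coord_vector c (param c x) i)
                        (coord_vector c (param c x) j).
have hE x v w : chart_image c x ->
    hform (A x) v w = hform (h (param c x)) (from_chart c (param c x) v)
                                            (from_chart c (param c x) w).
  move=> cx; rewrite !from_chart_sum hform_suml; apply: eq_bigr => i _.
  rewrite hformZl hform_sumr mulr_sumr; apply: eq_bigr => j _.
  by rewrite hformZr mxE; ring.
have uA x : chart_image c x -> A x \in unitmx.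
  move=> cx; apply: posdef_unitmx => v v0; rewrite hE//; apply: ph.
  have [dx _] := chart_image_dom cx.
  apply: contra v0 => /eqP fv.
  by rewrite -(to_chartK dx v) fv to_chart0.
have sA i j : csmooth_on (chart_image c) (fun x => A x i j).
  by apply: csmooth_on_ext (oc c) _ (sh c i j) => // x _; rewrite mxE.
pose beta x : 'rV[C]_n :=
  \row_l pairing (b (param c x)) (coord_vector c (param c x) l).
(* Taking duals commutes with the change of components: both sides have the same image under the
   injective map [flat (A x)], as pairing with every [v] shows. *)
have sE x : chart_image c x ->
    to_chart c (param c x) (sharp (h (param c x)) (b (param c x))) =
    sharp (A x) (beta x).
  move=> cx; have [dx _] := chart_image_dom cx.
  apply: (can_inj (flatK (uA x cx))); rewrite flat_sharp ?uA//.
  apply: pairing_inj => v; rewrite pairing_flat hE// from_chartK//.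
  rewrite -pairing_flat flat_sharp; last exact: posdef_unitmx.
  rewrite from_chart_sum pairing_sumr; apply: eq_bigr => l _.
  by rewrite pairingZr !mxE mulrC.
apply: csmooth_on_ext (oc c) _ (csmooth_on_conj (oc c)
  (csmooth_on_sum (index_enum 'I_n) xpredT (oc c)
  (fun l => csmooth_onM (oc c) (sb c l) (csmooth_on_invmx (oc c) uA sA k l)))) => //.
move=> x cx; rewrite sE// !mxE; congr (_^*); apply: eq_bigr => l _.
by rewrite -trmx_inv !mxE.
Qed.

End SmoothTensors.

(** * Navigation *)

Section Navigation.
Context {R : realType} {n : nat} {M : complex_manifold R n}.
Local Notation C := (Cx R).
Implicit Types (F : M -> 'rV[C]_n -> R) (h : M -> 'M[C]_n) (f : M -> R).
Implicit Types (W : M -> 'rV[C]_n) (phi : R).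

Lemma randers_solves_navigation F : complex_randers F ->
  exists h f W phi, [/\ solves_navigation F h f W phi,
    forall p, 0 < hnorm (h p) (W p) & cos phi = -1].
Proof.
move=> [a [b [ha sb b01 FE]]]; have [Ha pa _] := ha.
pose X p := sharp (a p) (b p); pose B p := hnorm (a p) (X p) ^+ 2.
have bE p : flat (a p) (X p) = b p by rewrite flat_sharp ?posdef_unitmx.
have aX p v : hform (a p) v (X p) = pairing (b p) v by rewrite -pairing_flat bE.
have B01 p : 0 < B p < 1 by rewrite /B -conorm2_flat// bE.
have B1 p : 0 < 1 - B p by rewrite subr_gt0; have /andP[] := B01 p.
have sX : smooth_vector_field X by exact: smooth_sharp.
have sB : smooth_function (fun p => 1 - B p).
  apply: smooth_functionB; [exact: smooth_function_cst|exact: smooth_hnorm2].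
pose h p := toC (1 - B p) *: a p + toC (- (1 - B p)) *: outer (b p).
pose W p := toC (1 - B p)^-1 *: X p.
have ph p : posdef (h p).
  exact: (zermelo_posdef (Ha p) (pa p) (aX p) erefl (B01 p)).
have WE p : hnorm (h p) (W p) ^+ 2 = B p.
  exact: (zermelo_hnormW (Ha p) (pa p) (aX p) erefl (B01 p)).
have W0 p : 0 < hnorm (h p) (W p).
  rewrite lt_def hnorm_ge0 andbT; have /andP[+ _] := B01 p.
  by rewrite -WE; apply: contraTN => /eqP ->; rewrite expr0n ltxx.
(* Unit speed makes eps = 1 - B, and the angle [pi] has cosine -1. *)
exists h, (fun=> 1), W, pi; split; [|exact: W0|exact: cospi].
split; [split|left; split].
- by apply: hermitian_metric_rank1 => //; exact: smooth_functionN.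
- exact: smooth_function_cst.
- by apply: smooth_vector_fieldZ => //; exact: smooth_functionV.
- move=> p; rewrite lexx andbT -(ltr_pXn2r (n := 2))// ?nnegrE ?hnorm_ge0//.
  by rewrite WE expr1n; have /andP[] := B01 p.
- by move=> p; rewrite -(hnorm_gt0 _ (ph p)).
- move=> p v; rewrite FE /nav_formula cospi.
  exact/esym/(zermelo_solution (Ha p) (pa p) (aX p) erefl (B01 p)).
Qed.

Lemma nav_eps_gt0 h f W p : navigation_data h f W -> 0 < nav_eps h f W p.
Proof. by move=> [_ _ _ /(_ p)/andP[Wf _]]; exact: eps_gt0. Qed.

Lemma speed_gt0 h f W p : navigation_data h f W -> 0 < f p.
Proof.
by move=> [_ _ _ /(_ p)/andP[Wf _]]; exact: le_lt_trans (hnorm_ge0 _ _) Wf.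
Qed.

Lemma solves_navigation_randers F h f W phi :
  solves_navigation F h f W phi -> (forall p, 0 < hnorm (h p) (W p)) ->
  cos phi = -1 -> complex_randers F.
Proof.
move=> [hfW sol] W0 cphi; have [hh sf sW Wf] := hfW; have [Hh ph _] := hh.
have FE p v : F p v = nav_formula h f W phi p v.
  case: sol => [[_ ->//]|[/(_ p) Wp _]].
  by have := W0 p; rewrite Wp hnorm0 ltxx.
have se : smooth_function (fun p => (nav_eps h f W p)^-1).
  by apply: smooth_functionV; [move=> p; exact: nav_eps_gt0|exact: smooth_nav_eps].
pose b p := toC (nav_eps h f W p)^-1 *: flat (h p) (W p).
have sb : smooth_form b by exact/smooth_formZ/smooth_flat.
have Wfp p : hnorm (h p) (W p) < f p by have /andP[] := Wf p.
exists (fun p => toC (nav_eps h f W p)^-1 *: h p + toC 1 *: outer (b p)), b.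
split => // [|p|p v].
- apply: hermitian_metric_rank1 => //; first exact: smooth_function_cst.
  by move=> p; exact: randers_posdef.
- exact: randers_conorm2_lt1.
- by rewrite FE /nav_formula cphi; exact/esym/randers_solution.
Qed.

Lemma nav_formula_cos0 h f W phi p v : navigation_data h f W -> cos phi = 0 ->
  nav_formula h f W phi p v = (Num.sqrt (nav_eps h f W p))^-1 * hnorm (h p) v.
Proof.
move=> hfW cphi; have := nav_eps_gt0 p hfW; rewrite /nav_formula cphi.
move: (nav_eps h f W p) => e e0.
rewrite expr0n mulr0 add0r mulr0 subr0 sqrtrM ?sqr_ge0// sqrtr_sqr.
(* The denominator [e] is written as the square of its root, so that one root cancels. *)
rewrite ger0_norm ?hnorm_ge0// -{2}[e]sqr_sqrtr ?ltW//.
by field; rewrite gt_eqF ?sqrtr_gt0.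
Qed.

(** Matches the two cases in [solves_navigation] with the two winds considered; a mixed case is
    contradictory at the point where [F] is evaluated. *)
Lemma solves_navigation_hermitian F h f W phi :
  solves_navigation F h f W phi ->
  ((forall p, 0 < hnorm (h p) (W p)) /\ cos phi = 0) \/ zero_wind W ->
  [/\ forall p, 0 < hnorm (h p) (W p), cos phi = 0 &
      forall p v, F p v = (Num.sqrt (nav_eps h f W p))^-1 * hnorm (h p) v] \/
  (zero_wind W /\ forall p v, F p v = (f p)^-1 * hnorm (h p) v).
Proof.
move=> [hfW sol] [[W0 cphi]|W0].
  left; split=> // p v; case: sol => [[_ FE]|[/(_ p) Wp _]].
    by rewrite FE nav_formula_cos0.
  by have := W0 p; rewrite Wp hnorm0 ltxx.
right; split=> // p v; case: sol => [[/(_ p)+ _]|[_ //]].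
by rewrite W0 eqxx.
Qed.

Lemma solves_navigation_conformal F h f W phi :
  solves_navigation F h f W phi ->
  ((forall p, 0 < hnorm (h p) (W p)) /\ cos phi = 0) \/ zero_wind W ->
  conformal F h.
Proof.
move=> sol alt; have [hfW _] := sol; have [hh sf _ _] := hfW; split=> //.
have [[_ _ FE]|[_ FE]] := solves_navigation_hermitian sol alt.
  exists (fun p => (Num.sqrt (nav_eps h f W p))^-1).
  have e0 p : 0 < nav_eps h f W p by exact: nav_eps_gt0.
  split=> // [|p]; last by rewrite invr_gt0 sqrtr_gt0.
  apply: smooth_functionV => [p|]; first by rewrite sqrtr_gt0.
  by apply: smooth_function_sqrt => //; exact: smooth_nav_eps.
have f0 p : 0 < f p by exact: speed_gt0 hfW.
exists (fun p => (f p)^-1); split=> // [|p]; last by rewrite invr_gt0.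
exact: smooth_functionV.
Qed.

(** The factor is absorbed into the metric rho^2 h at unit speed; keeping [h] with speed 1/rho would
    violate the bound f <= 1 wherever rho < 1. *)
Lemma conformal_solves_navigation F h : conformal F h ->
  exists h', solves_navigation F h' (fun=> 1) (fun=> 0) 0.
Proof.
move=> [hh [rho [srho rho0 FE]]].
exists (fun p => toC (rho p ^+ 2) *: h p); split.
  split; last by move=> p; rewrite hnorm0 ltr01 lexx.
  - apply: hermitian_metricZ => // [|p]; first exact: smooth_functionM.
    exact: exprn_gt0.
  - exact: smooth_function_cst.
  - exact: smooth_vector_field0.
by right; split=> // p v; rewrite FE hnorm_scale ?ltW// invr1 mul1r.
Qed.

Lemma homothetic_conformal F h : homothetic F h -> conformal F h.
Proof.
move=> [hh [rho rho0 FE]]; split=> //; exists (fun=> rho); split=> //.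
exact: smooth_function_cst.
Qed.

Lemma homothetic_of_constant F h (rho : M -> R) : hermitian_metric h ->
  (forall p, 0 < rho p) -> (forall p v, F p v = rho p * hnorm (h p) v) ->
  constant_function rho -> homothetic F h.
Proof.
move=> hh rho0 FE [k rhok]; split=> //.
(* A point of [M] is what makes the constant [k] positive; on an empty manifold the factor 1 is
   taken instead. *)
have [[p _]|noM] := pselect (exists p : M, True).
  by exists k => [|q v]; [rewrite -(rhok p)|rewrite FE rhok].
by exists 1 => // p; case: noM; exists p.
Qed.

(** Comparing the two expressions for [F] on one nonzero vector determines the factor; positive
    dimension provides the vector. *)
Lemma homothetic_constant F h (rho : M -> R) : (0 < n)%N ->
  (forall p v, F p v = rho p * hnorm (h p) v) ->
  homothetic F h -> constant_function rho.
Proof.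
move=> n0 FE [[_ ph _] [k _ FE']]; exists k => p.
pose v : 'rV[C]_n := delta_mx 0 (Ordinal n0).
have v0 : 0 < hnorm (h p) v.
  rewrite hnorm_gt0//; apply/eqP => /rowP/(_ (Ordinal n0)).
  by rewrite !mxE !eqxx => /eqP; rewrite oner_eq0.
by apply: (mulIf (lt0r_neq0 v0)); rewrite -FE -FE'.
Qed.

Lemma solves_navigation_homothetic F h f W phi : (0 < n)%N ->
  solves_navigation F h f W phi ->
  ((forall p, 0 < hnorm (h p) (W p)) /\ cos phi = 0) \/ zero_wind W ->
  homothetic F h <->
  [/\ forall p, 0 < hnorm (h p) (W p), cos phi = 0 &
      constant_function (nav_eps h f W)] \/
  (zero_wind W /\ constant_function f).
Proof.
move=> n0 sol alt; have [hfW _] := sol; have [hh _ _ _] := hfW.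
have e0 p : 0 < nav_eps h f W p by exact: nav_eps_gt0.
have f0 p : 0 < f p by exact: speed_gt0 hfW.
split=> [homo|alt'].
  have [[W0 cphi FE]|[W0 FE]] := solves_navigation_hermitian sol alt.
    left; split=> //; have [k ke] := homothetic_constant n0 FE homo.
    (* The factor is 1/sqrt eps = k, hence eps = (1/k)^2. *)
    by exists (k^-1 ^+ 2) => p; rewrite -(ke p) invrK sqr_sqrtr ?ltW.
  right; split=> //; have [k kf] := homothetic_constant n0 FE homo.
  by exists k^-1 => p; rewrite -(kf p) invrK.
have [[W0 cphi [k ke]]|[W0 [k kf]]] := alt'.
  have FE p v : F p v = (Num.sqrt (nav_eps h f W p))^-1 * hnorm (h p) v.
    have [[_ _ //]|[Wz _]] := solves_navigation_hermitian sol alt.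
    by have := W0 p; rewrite Wz hnorm0 ltxx.
  apply: homothetic_of_constant FE _ => // [p|]; first by rewrite invr_gt0 sqrtr_gt0.
  by exists (Num.sqrt k)^-1 => p; rewrite ke.
have FE p v : F p v = (f p)^-1 * hnorm (h p) v.
  have [[+ _ _]|[_ //]] := solves_navigation_hermitian sol alt.
  by move/(_ p); rewrite W0 hnorm0 ltxx.
apply: homothetic_of_constant FE _ => // [p|]; first by rewrite invr_gt0.
by exists k^-1 => p; rewrite kf.
Qed.

End Navigation.

Theorem theorem3p8 (R : realType) (n : nat) (n_gt0 : (0 < n)%N)
    (M : complex_manifold R n) (F : M -> 'rV[Cx R]_n -> R)
    (F_finsler : complex_finsler F) :
  (* (i) *)
  (complex_randers F <->
   exists (h : M -> 'M[Cx R]_n) (f : M -> R) (W : M -> 'rV[Cx R]_n) (phi : R),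
     [/\ solves_navigation F h f W phi,
         forall p, 0 < hnorm (h p) (W p) &
         cos phi = -1])
  /\
  (* (ii), conformal case: existence of a background metric, and conformality
     to the background metric of every such navigation problem *)
  ((exists h : M -> 'M[Cx R]_n, conformal F h) <->
   exists (h : M -> 'M[Cx R]_n) (f : M -> R) (W : M -> 'rV[Cx R]_n) (phi : R),
     solves_navigation F h f W phi /\
     (((forall p, 0 < hnorm (h p) (W p)) /\ cos phi = 0) \/ zero_wind W))
  /\
  (forall (h : M -> 'M[Cx R]_n) (f : M -> R) (W : M -> 'rV[Cx R]_n) (phi : R),
     solves_navigation F h f W phi ->
     ((forall p, 0 < hnorm (h p) (W p)) /\ cos phi = 0) \/ zero_wind W ->
     conformal F h)
  /\
  (* (ii), homothetic case *)
  ((exists h : M -> 'M[Cx R]_n, homothetic F h) <->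
   exists (h : M -> 'M[Cx R]_n) (f : M -> R) (W : M -> 'rV[Cx R]_n) (phi : R),
     solves_navigation F h f W phi /\
     ([/\ forall p, 0 < hnorm (h p) (W p), cos phi = 0 &
          constant_function (nav_eps h f W)] \/
      (zero_wind W /\ constant_function f)))
  /\
  (forall (h : M -> 'M[Cx R]_n) (f : M -> R) (W : M -> 'rV[Cx R]_n) (phi : R),
     solves_navigation F h f W phi ->
     ((forall p, 0 < hnorm (h p) (W p)) /\ cos phi = 0) \/ zero_wind W ->
     (homothetic F h <->
      ([/\ forall p, 0 < hnorm (h p) (W p), cos phi = 0 &
           constant_function (nav_eps h f W)] \/
       (zero_wind W /\ constant_function f)))).
Proof.
split; [|split; [|split; [|split]]].
- split; first exact: randers_solves_navigation.
  by move=> [h [f [W [phi [sol W0 cphi]]]]]; exact: solves_navigation_randers sol _ _.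
- split=> [[h /conformal_solves_navigation[h' sol]]|].
    by exists h', (fun=> 1), (fun=> 0), 0; split=> //; right.
  move=> [h [f [W [phi [sol alt]]]]].
  by exists h; exact: solves_navigation_conformal sol alt.
- by move=> h f W phi; exact: solves_navigation_conformal.
(* From left to right the metric is replaced by its rescaling, for which there is no wind and the
   speed is the constant 1; from right to left the metric [h] is kept. *)
- split=> [[h /homothetic_conformal/conformal_solves_navigation[h' sol]]|].
    by exists h', (fun=> 1), (fun=> 0), 0; split=> //; right; split=> //; exists 1.
  move=> [h [f [W [phi [sol alt]]]]]; exists h.
  apply/(solves_navigation_homothetic n_gt0 sol) => //.
  by case: alt => [[]|[]]; [left|right].
- by move=> h f W phi; exact: solves_navigation_homothetic.
Qed.
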